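(* Let $q=p^t$ with $p$ prime and $t\ge 1$, let $V$ be a $4$-dimensional vector space over $\mathbb{F}_q$, and let $A$ be the $0/1$ matrix, viewed as an integer matrix, whose rows and columns are both indexed by the $2$-dimensional subspaces of $V$ (in a fixed order), with $(U,W)$-entry equal to $1$ if and only if $U\cap W=\{0\}$. For $i\ge 0$ let $e_i=e_i(A)$ denote the multiplicity of $p^i$ as an elementary divisor of $A$ (i.e. in the Smith normal form of $A$ over $\mathbb{Z}$). Then: (1) $e_i=e_{3t-i}$ for $0\le i<t$; (2) $e_i=0$ for $t<i<2t$, for $3t<i<4t$, and for $i>4t$; (3) $\sum_{i=0}^{t}e_i=q^4+q^2$; (4) $\sum_{i=2t}^{3t}e_i=q^3+q^2+q$; (5) $e_{4t}=1$.
   Context: All elementary divisors of $A$ are powers of $p$ (so the numbers $e_i$ describe the full Smith normal form of $A$). *)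

(* Defs.v *)
From HB Require Import structures.
From mathcomp Require Import all_boot all_order all_algebra.
Set Implicit Arguments. Unset Strict Implicit. Unset Printing Implicit Defensive.
Import Order.TTheory GRing.Theory Num.Theory.
Local Open Scope ring_scope.

(* 2-dimensional subspaces of V = F^4 (row vectors), each represented by its
   canonical matrix <<U>>%MS (so distinct subspaces <-> distinct representatives). *)
Definition subsp2 (F : finFieldType) : {set 'M[F]_4} :=
  [set U : 'M[F]_4 | (\rank U == 2)%N && (<<U>>%MS == U)].

Definition disj_mx (F : finFieldType) : 'M[int]_(#|subsp2 F|) :=
  \matrix_(i, j)
    (((enum_val i :&: enum_val j)%MS == 0 :> 'M[F]_4) : nat)%:Z.

Definition snf_diag m n (M : 'M[int]_(m, n)) : seq int :=
  let: existT2 _ _ (existT2 _ _ (exist2 d _ _)) :=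
    int_Smith_normal_form M in d.

Definition edmult n (M : 'M[int]_n) (p i : nat) : nat :=
  \sum_(k < n) ((absz (nth (0 : int) (snf_diag M) k) == (p ^ i)%N) : nat)%N.

(* Main.v *)
Require Import Defs.
From HB Require Import structures.
From mathcomp Require Import all_boot all_order all_algebra.
From mathcomp Require Import mxabelem.
From mathcomp Require Import zify ring.
Import Order.TTheory GRing.Theory Num.Theory.

(* With J the all-one matrix and M := J + q I - A, the (U, W)-entry of (q - 1) M is the
   number of nonzero vectors in the intersection of U and W: (q - 1) M = N^T N for the
   incidence matrix N of nonzero vectors against 2-dimensional subspaces, called lines.
   Counting the lines through two vectors gives M^2 = (q + 1)^2 J + (q^2 + q) M and
   hence A^2 + (q^2 - q) A = q^3 I + q^3 (q - 1) J.

   The number of lines is prime to p, so over the p-adic integers the lattice splits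
   into the all-one vector, on which A is q^4, and the sum-zero lattice Y, on which
   A (A + (q^2 - q) I) = q^3 I.  Let G_i be the number of elementary divisors of A on Y
   divisible by p^i, and m the rank of Y.
   - A + (q^2 - q) I is congruent to A modulo p^t and has elementary divisors q^3 / d,
     whence G_i + G_(3t-i+1) = m for i <= t.
   - On Y the eigenvalues of A are q and - q^2, with multiplicities f = q^4 + q^2 and
     g = q^3 + q^2 + q.  The eigenlattices are pure, so those of - q^2 and q yield
     G_(2t) >= g and m - G_(t+1) >= f.  As f + g = m, both are equalities. *)

Set Implicit Arguments. Unset Strict Implicit. Unset Printing Implicit Defensive.
Local Open Scope ring_scope.

(** * Elementary divisors and reduction modulo p *)

(** The matrix factors through the coordinate space indexed by its support. *)
Lemma rank_diag_mx_le (K : fieldType) n (d : 'rV[K]_n) :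
  (\rank (diag_mx d) <= #|[set k | (d 0 k != 0)%R]|)%N.
Proof.
set S := [set k | _].
pose B : 'M[K]_(n, #|S|) := \matrix_(i, j) (if i == enum_val j then d 0 i else 0).
pose C : 'M[K]_(#|S|, n) := \matrix_(j, i) (enum_val j == i)%:R.
suff -> : diag_mx d = B *m C by apply: leq_trans (mxrankM_maxl _ _) (rank_leq_col _).
apply/matrixP=> i j; rewrite !mxE.
have [iS|iS] := boolP (i \in S); last first.
  rewrite big1 => [|k _]; first by move: iS; rewrite inE negbK => /eqP ->; rewrite mul0rn.
  rewrite !mxE; case: eqP => [ik|_]; last by rewrite mul0r.
  by rewrite ik enum_valP in iS.
rewrite (bigD1 (enum_rank_in iS i)) //= !mxE enum_rankK_in // eqxx mulr_natr.
rewrite big1 ?addr0 // => k; apply: contraNeq => nz.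
have: i == enum_val k by move: nz; rewrite !mxE; case: ifP; rewrite // mul0r eqxx.
by move/eqP=> ik; apply/eqP/enum_val_inj; rewrite enum_rankK_in.
Qed.

(** For the lower bound, the diagonal matrices of [S] and [~: S] add up to the identity, and rank is
    subadditive. *)
Lemma rank_diag_indicator (K : fieldType) n (S : {set 'I_n}) :
  \rank (diag_mx (\row_k (k \in S)%:R) : 'M[K]_n) = #|S|.
Proof.
have le (P : {set 'I_n}) : (\rank (diag_mx (\row_k (k \in P)%:R) : 'M[K]_n) <= #|P|)%N.
  apply: leq_trans (rank_diag_mx_le _) (subset_leq_card _).
  by apply/subsetP=> k; rewrite inE mxE; case: (k \in P); rewrite ?eqxx.
apply/eqP; rewrite eqn_leq le /=.
have := mxrank_add (diag_mx (\row_k (k \in S)%:R) : 'M[K]_n)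
                   (diag_mx (\row_k (k \in ~: S)%:R)).
rewrite -linearD /= (_ : \row__ _ + _ = const_mx 1) ?diag_const_mx ?mxrank1.
  have := le (~: S); have := cardsC S; rewrite card_ord => cS h1 h2.
  by rewrite -(leq_add2r #|~: S|) cS (leq_trans h2) // leq_add2l.
by apply/rowP=> k; rewrite !mxE inE; case: (k \in S); rewrite ?addr0 ?add0r.
Qed.

(** For prime [p] this is invertibility over the integers localized at [p]. It covers the basis
    change to the sum-zero lattice, which need not be unimodular. *)
Definition prime_to_det (p : nat) n (Q : 'M[int]_n) := ~~ (p %| \det Q)%Z.

Lemma prime_to_det_unit p n (Q : 'M[int]_n) :
  prime p -> Q \in unitmx -> prime_to_det p Q.
Proof.
move=> pp uQ; apply/negP=> pd.
have: (p %| 1%R)%Z by rewrite -(@det1 int n) -(mulVmx uQ) det_mulmx dvdz_mull.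
by rewrite dvdzE dvdn1 eqn_leq leqNgt prime_gt1.
Qed.

Lemma prime_to_detM p n (P Q : 'M[int]_n) : prime p ->
  prime_to_det p P -> prime_to_det p Q -> prime_to_det p (P *m Q).
Proof.
move=> pp; rewrite /prime_to_det det_mulmx !dvdzE abszM Euclid_dvdM //.
by rewrite negb_or => -> ->.
Qed.

(* Frobenius-Koenig modulo p. *)
Lemma zero_block p n (Q : 'M[int]_n) (S P : {set 'I_n}) :
  prime p -> prime_to_det p Q ->
  (forall i j, i \notin P -> j \in S -> (p %| Q i j)%Z) -> (#|S| <= #|P|)%N.
Proof.
move=> pp; rewrite /prime_to_det (dvdz_pcharf (pchar_Fp pp)) -det_map_mx => uQ zQ.
rewrite -(rank_diag_indicator 'F_p S) -(rank_diag_indicator 'F_p P).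
rewrite -(@eqmxMfull _ _ _ _ (map_mx intr Q)); last first.
  by rewrite row_full_unit unitmxE unitfE.
(* Modulo [p] the columns of [Q] in [S] are supported on [P], so projecting to [P] fixes [Z]. *)
set Z := _ *m _; suff ->: Z = diag_mx (\row_k (k \in P)%:R) *m Z by apply: mxrankM_maxl.
apply/matrixP=> i j; rewrite mul_diag_mx /Z mul_mx_diag !mxE.
have [|iP] := boolP (i \in P); first by rewrite mul1r.
have [jS|] := boolP (j \in S); last by rewrite !mulr0.
by have := zQ i j iP jS; rewrite (dvdz_pcharf (pchar_Fp pp)) => /eqP ->; rewrite !mul0r.
Qed.

Lemma dvdz_pow_cancel p i (a b : int) : prime p ->
  (p%:Z ^+ i %| a * b)%Z -> ~~ (p%:Z ^+ i %| a)%Z -> (p %| b)%Z.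
Proof.
move=> pp H; apply: contraR => nb; rewrite -(@Gauss_dvdzl _ a b) //.
by rewrite coprimezE abszX coprimeXl // prime_coprime.
Qed.

(** For the Smith diagonal of [A] on [Y] these are the numbers [G_i]. *)
Definition dvd_count n (d : 'rV[int]_n) (p i : nat) : nat :=
  #|[set k | (p%:Z ^+ i %| d 0%R k)%Z]|.

(** Modulo [p ^ i] the hypothesis reads [P diag(d) = diag(d') Q]. Where [p ^ i] divides [d_j] but
    not [d'_k], it forces [p] to divide [Q k j]: this is the block for [zero_block]. *)
Lemma count_dvd_le p i n (P Q : 'M[int]_n) (d d' : 'rV[int]_n) :
  prime p -> prime_to_det p Q ->
  (forall k j, (p%:Z ^+ i %| P k j * d 0%R j - d' 0%R k * Q k j)%Z) ->
  (dvd_count d p i <= dvd_count d' p i)%N.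
Proof.
move=> pp uQ H; apply: (zero_block pp uQ) => k j; rewrite !inE => nk dj.
apply: (dvdz_pow_cancel pp _ nk).
by rewrite -[X in (_ %| X)%Z](subKr (P k j * d 0 j)) rpredB ?dvdz_mull.
Qed.

(** Transposing the congruence gives the reverse inequality, with [P^T] in the role of [Q]. *)
Lemma count_dvd_eq p i n (P Q : 'M[int]_n) (d d' : 'rV[int]_n) :
  prime p -> prime_to_det p P -> prime_to_det p Q ->
  (forall k j, (p%:Z ^+ i %| P k j * d 0%R j - d' 0%R k * Q k j)%Z) ->
  dvd_count d p i = dvd_count d' p i.
Proof.
move=> pp uP uQ H; apply/eqP; rewrite eqn_leq (count_dvd_le pp uQ H) /=.
apply: (@count_dvd_le _ _ _ Q^T P^T) => //; first by rewrite /prime_to_det det_tr.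
by move=> k j; rewrite !mxE -rpredN opprB [_ * d' _ _]mulrC [d _ _ * _]mulrC.
Qed.

Lemma snf_exists n (M : 'M[int]_n) : exists L R d,
  [/\ L \in unitmx, R \in unitmx, M = L *m diag_mx d *m R &
    forall p i, edmult M p i = #|[set k | `|d 0%R k|%N == (p ^ i)%N]|].
Proof.
rewrite /edmult /snf_diag; case: int_Smith_normal_form => L uL [R uR [d _ MD]].
exists L, R, (\row_k d`_k); split=> //.
  rewrite MD; congr (_ *m _ *m _); apply/matrixP=> i j; rewrite !mxE //.
by move=> p i; rewrite -sum1dep_card [RHS]big_mkcond; apply: eq_bigr => k _; rewrite mxE; case: eqP.
Qed.

(** In a full-rank factorization [E = C B] idempotence forces [B C = 1], and [B C] has the trace of
    [E]. *)
Lemma trace_idempotent (K : fieldType) n (E : 'M[K]_n) :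
  E *m E = E -> \tr E = (\rank E)%:R.
Proof.
move=> EE; rewrite -{1}(mulmx_base E) mxtrace_mulC.
suff ->: row_base E *m col_base E = 1%:M by rewrite mxtrace1.
apply: (row_free_inj (row_base_free E)); apply: (row_full_inj (col_base_full E)) => /=.
by rewrite mul1mx -[X in _ *m X = _]mulmxA mulmx_base (mulmxA (col_base E)) mulmx_base.
Qed.

(* An eigenspace of an integer matrix meets the lattice in a pure sublattice, so a
   suitable unimodular matrix contains a basis of it among its columns. *)
Lemma pure_eigenlattice n (A X : 'M[int]_n) (c : int) :
  A *m X = c *: X ->
  exists L (S : {set 'I_n}), [/\ L \in unitmx, (\rank (map_mx intr X : 'M[rat]_n) <= #|S|)%N &
    forall i j, j \in S -> (A *m L) i j = c * L i j].
Proof.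
move=> AX; have [L [R [d [uL uR XD _]]]] := snf_exists X.
exists L, [set k | d 0 k != 0]; split=> //.
  rewrite XD !map_mxM; apply: leq_trans (mxrankM_maxl _ _) _.
  apply: leq_trans (mxrankM_maxr _ _) _; rewrite map_diag_mx.
  apply: leq_trans (rank_diag_mx_le _) (subset_leq_card _).
  by apply/subsetP=> k; rewrite !inE mxE intr_eq0.
(* [R] cancels from [A X = c X], and column [j] may then be divided by the nonzero [d 0 j]. *)
move=> i j; rewrite inE => dj; apply: (mulIf dj).
have /matrixP/(_ i j): A *m L *m diag_mx d = c *: (L *m diag_mx d).
  by move: AX; rewrite XD !mulmxA scalemxAl => /(congr1 (mulmx^~ (invmx R))); rewrite /= !mulmxK.
by rewrite !mul_mx_diag !mxE => ->; rewrite mulrA.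
Qed.

(** Conjugating [A B = c] by [L] gives [diag(d) (R B L) = c]. For nonzero [c], [R B L] is thus
    diagonal with entries [c / d_k]. *)
Lemma snf_inverse n (A B L R : 'M[int]_n) (d : 'rV[int]_n) (c : int) :
  L \in unitmx -> A = L *m diag_mx d *m R -> A *m B = c%:M ->
  forall k j, d 0 k * (R *m B *m L) k j = c *+ (k == j).
Proof.
move=> uL AD AB k j.
have /matrixP/(_ k j) : diag_mx d *m (R *m B *m L) = c%:M.
  transitivity (invmx L *m (A *m B) *m L); first by rewrite AD !mulmxA mulVmx // mul1mx.
  by rewrite AB scalar_mxC -mulmxA mulVmx // mulmx1.
by rewrite mul_diag_mx !mxE.
Qed.

(** [(A - b) / (a - b)] is a rational idempotent, so its rank is its trace. *)
Lemma rank_eigen m (A : 'M[int]_m) (a b : int) (f : nat) :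
  a != b -> (A - a%:M) *m (A - b%:M) = 0 ->
  \tr A - m%:Z * b = (a - b) * f%:Z ->
  \rank (map_mx intr (A - b%:M) : 'M[rat]_m) = f.
Proof.
move=> ab AA trA; pose X : 'M[rat]_m := map_mx intr (A - b%:M).
have nz : (a - b)%:~R != 0 :> rat by rewrite intr_eq0 subr_eq0.
have XX : X *m X = (a - b)%:~R *: X.
  rewrite -map_mxM -map_mxZ; congr map_mx; rewrite -mul_scalar_mx; apply/eqP.
  rewrite -subr_eq0 -mulmxBl; suff -> : A - b%:M - (a - b)%:M = A - a%:M by rewrite AA.
  by rewrite raddfB /= opprB addrA subrK.
have EE : ((a - b)%:~R^-1 *: X) *m ((a - b)%:~R^-1 *: X) = (a - b)%:~R^-1 *: X.
  by rewrite -scalemxAl -scalemxAr XX (scalerA _ _ X) mulVf // scale1r.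
have /eqP := trace_idempotent EE.
rewrite mxtraceZ eqmx_scale ?invr_eq0 // -/X => /eqP trE.
have : \tr X = (a - b)%:~R * f%:R.
  have -> : \tr X = (\tr (A - b%:M))%:~R by rewrite /X raddf_sum; apply: eq_bigr => i _; rewrite !mxE.
  by rewrite raddfB /= mxtrace_scalar -[b *+ m]mulr_natl natz trA intrM.
by move=> trX; move: trE; rewrite trX mulKf // => /eqP; rewrite eqr_nat => /eqP.
Qed.

(** The valuation of [w_k] is at least [i] exactly when that of [d_k] is at most [K - i]. *)
Lemma dvd_count_compl p K i n (d w : 'rV[int]_n) : prime p -> (i <= K)%N ->
  (forall k, d 0%R k * w 0%R k = p%:Z ^+ K) ->
  (dvd_count w p i + dvd_count d p (K - i).+1)%N = n.
Proof.
move=> pp iK dw; rewrite /dvd_count.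
rewrite [X in (_ + X)%N = _](eq_card (B := ~: [set k | (p%:Z ^+ i %| w 0%R k)%Z])).
  by rewrite cardsC card_ord.
move=> k; have {}dw : (`|d 0%R k| * `|w 0%R k|)%N = (p ^ K)%N by rewrite -abszM dw abszX.
have /(dvdn_pfactor _ _ pp)[v vK Dv] : (`|d 0%R k| %| p ^ K)%N by rewrite -dw dvdn_mulr.
move/eqP: dw; rewrite Dv -{1}(subnK vK) expnD mulnC eqn_pmul2r ?expn_gt0 ?prime_gt0 //.
by move/eqP=> Wk; rewrite !inE !dvdzE !abszX Dv Wk !dvdn_Pexp2l ?prime_gt1 //; lia.
Qed.

(** * Elementary divisors of a matrix with eigenvalues [q] and [- q ^+ 2] *)

Section TwoEigenvalues.

Variables (p t m : nat) (A : 'M[int]_m) (f g : nat).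
Variable q : int.
Hypotheses (qE : q = p%:Z ^+ t) (p_pr : prime p) (fg : (f + g)%N = m).
Hypothesis AE : A *m (A + (q ^+ 2 - q)%:M) = (q ^+ 3)%:M.
Hypothesis trA : \tr A + m%:Z * q ^+ 2 = (q ^+ 2 + q) * f%:Z.

Let q_gt0 : 0 < q. Proof. by rewrite qE exprn_gt0 // ltz_nat prime_gt0. Qed.

(** The roots of [x^2 + (q^2 - q) x - q^3] are [q] and [- q^2]; they stay symbolic so that either
    order is available. *)
Let factored (a b : int) : a + b = q - q ^+ 2 -> a * b = - q ^+ 3 ->
  (A - a%:M) *m (A - b%:M) = 0.
Proof.
move=> sab pab; have AA : A *m A = (q ^+ 3)%:M - (q ^+ 2 - q) *: A.
  by rewrite -AE mulmxDr scalar_mxC mul_scalar_mx addrK.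
rewrite mulmxBr !mulmxBl AA -scalar_mxM scalar_mxC !mul_scalar_mx.
have -> : q ^+ 3 = - (a * b) by rewrite pab opprK.
have -> : q ^+ 2 - q = - (a + b) by rewrite sab opprB.
by apply/matrixP=> i j; rewrite !mxE; case: (i == j); rewrite ?mulr1n ?mulr0n; ring.
Qed.

Variables (L R : 'M[int]_m) (d : 'rV[int]_m).
Hypotheses (uL : L \in unitmx) (uR : R \in unitmx) (AD : A = L *m diag_mx d *m R).

Lemma snf_dvd_cube k : (d 0%R k %| q ^+ 3)%Z.
Proof.
have := snf_inverse uL AD AE k k; rewrite eqxx mulr1n => <-.
by rewrite dvdz_mulr.
Qed.

Lemma count_eigen_ge : (g <= dvd_count d p (2 * t))%N.
Proof.
(* The columns of [A - q] are eigenvectors for [- q^2]; the trace gives their rank [g]. *)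
have [|L2 [S [uL2 rS AL2]]] := @pure_eigenlattice m A (A - q%:M) (- q ^+ 2).
  have /eqP : (A - (- q ^+ 2)%:M) *m (A - q%:M) = 0 by apply: factored; ring.
  by rewrite mulmxBl mul_scalar_mx subr_eq0 => /eqP.
rewrite (@rank_eigen _ _ (- q ^+ 2) q g) in rS; first last.
- by rewrite -(addKr (m%:Z * q ^+ 2) (\tr A)) [_ + \tr A]addrC trA -fg PoszD; ring.
- by apply: factored; ring.
- by rewrite eq_sym -subr_eq0 opprK gt_eqF // addr_gt0 ?exprn_gt0.
apply: (leq_trans rS); apply: (@zero_block p _ (R *m L2)) => //.
  by apply: prime_to_detM => //; apply: prime_to_det_unit.
move=> i j; rewrite inE => nd jS; apply: (dvdz_pow_cancel p_pr _ nd).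
(* On columns in [S], [diag(d) R L2 = L^-1 A L2 = - q^2 L^-1 L2] is divisible by [p ^ (2 * t)]. *)
suff -> : d 0 i * (R *m L2) i j = - q ^+ 2 * (invmx L *m L2) i j.
  by rewrite mulNr rpredN qE -exprM mulnC dvdz_mulr.
have <- : (diag_mx d *m (R *m L2)) i j = d 0 i * (R *m L2) i j by rewrite mul_diag_mx mxE.
have -> : diag_mx d *m (R *m L2) = invmx L *m (A *m L2) by rewrite AD -!mulmxA mulKmx.
by rewrite !mxE mulr_sumr; apply: eq_bigr => k _; rewrite AL2 //; ring.
Qed.

Lemma count_eigen_le : (dvd_count d p t.+1 <= g)%N.
Proof.
have [|L2 [S [uL2 rS AL2]]] := @pure_eigenlattice m A (A - (- q ^+ 2)%:M) q.
  have /eqP : (A - q%:M) *m (A - (- q ^+ 2)%:M) = 0 by apply: factored; ring.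
  by rewrite mulmxBl mul_scalar_mx subr_eq0 => /eqP.
rewrite (@rank_eigen _ _ q (- q ^+ 2) f) in rS; first last.
- by rewrite mulrN opprK trA; ring.
- by apply: factored; ring.
- by rewrite -subr_eq0 opprK gt_eqF // addr_gt0 ?exprn_gt0.
(* On columns in [S], [diag(d) R L2 = q L^-1 L2]. Where [p ^ t.+1] divides [d_i], the entries of
   [L^-1 L2] in row [i] are therefore divisible by [p]. *)
suff: (#|S| <= #|~: [set k | (p%:Z ^+ t.+1 %| d 0%R k)%Z]|)%N.
  move=> /(leq_trans rS); have := cardsC [set k | (p%:Z ^+ t.+1 %| d 0%R k)%Z].
  by rewrite card_ord -/(dvd_count d p t.+1) -[in RHS]fg; lia.
apply: (@zero_block p _ (invmx L *m L2)) => //.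
  by apply: prime_to_detM => //; apply: prime_to_det_unit => //; rewrite unitmx_inv.
move=> i j; rewrite !inE negbK => dd jS.
have : (p%:Z ^+ t.+1 %| q * (invmx L *m L2) i j)%Z.
  suff -> : q * (invmx L *m L2) i j = d 0 i * (R *m L2) i j by rewrite dvdz_mulr.
  have <- : (diag_mx d *m (R *m L2)) i j = d 0 i * (R *m L2) i j by rewrite mul_diag_mx mxE.
  have -> : diag_mx d *m (R *m L2) = invmx L *m (A *m L2) by rewrite AD -!mulmxA mulKmx.
  by rewrite !mxE mulr_sumr; apply: eq_bigr => k _; rewrite AL2 //; ring.
by rewrite exprSr -qE dvdz_mul2l ?gt_eqF.
Qed.

(** The diagonals [d] and [q^3 / d] can be compared only modulo [q = p ^ t], whence the bound on
    [i]. *)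
Lemma count_dual i : (i <= t)%N ->
  (dvd_count d p i + dvd_count d p (3 * t - i).+1)%N = m.
Proof.
move=> it; pose B := A + (q ^+ 2 - q)%:M; pose W := R *m B *m L.
have dW := snf_inverse uL AD AE.
have nzd k : d 0 k != 0.
  by apply: contraTneq (snf_dvd_cube k) => ->; rewrite dvd0z expf_eq0 gt_eqF.
rewrite (@count_dvd_eq p i m (R *m L) (invmx L *m invmx R) d (\row_k W k k)) //.
- apply: dvd_count_compl => // [|k]; first by rewrite (leq_trans it) ?leq_pmull.
  by rewrite mxE dW eqxx qE -exprM mulnC.
- by apply: prime_to_detM => //; apply: prime_to_det_unit.
- by apply: prime_to_detM => //; apply: prime_to_det_unit; rewrite // unitmx_inv.
move=> k j; rewrite [(\row__ _) _ _]mxE.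
(* W is diagonal, and congruent to R A L = (R L) diag(d) (R L) modulo q *)
have -> : W k k * (invmx L *m invmx R) k j = (W *m (invmx L *m invmx R)) k j.
  rewrite [RHS]mxE (bigD1 k) //= big1 ?addr0 // => l lk.
  suff -> : W k l = 0 by rewrite mul0r.
  by apply: (mulfI (nzd k)); rewrite dW eq_sym (negPf lk) mulr0.
have -> : W *m (invmx L *m invmx R) = R *m L *m diag_mx d + (q ^+ 2 - q)%:M.
  rewrite /W /B !mulmxA mulmxK // mulmxDr mulmxDl scalar_mxC -[X in _ + X]mulmxA mulmxV // mulmx1.
  by rewrite AD !mulmxA mulmxK.
rewrite mul_mx_diag !mxE opprD addrA subrr add0r rpredN.
rewrite (dvdz_trans (dvdz_exp2l p%:Z it)) // -qE; apply: rpredMn.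
by rewrite expr2 -{3}[q]mulr1 -mulrBr dvdz_mulr.
Qed.

End TwoEigenvalues.

(** Each [d_k] is up to sign a power of [p], so being [p ^ i] means having valuation exactly [i]. *)
Lemma dvd_count_exact p K n (d : 'rV[int]_n) i : prime p ->
  (forall k, (d 0%R k %| p%:Z ^+ K)%Z) ->
  (#|[set k | `|d 0%R k|%N == (p ^ i)%N]| + dvd_count d p i.+1)%N = dvd_count d p i.
Proof.
move=> pp dK; rewrite /dvd_count -cardsUI [X in (_ + X)%N]eq_card0 ?addn0 => [|k].
  apply: eq_card => k; rewrite !inE.
  have /(dvdn_pfactor _ _ pp)[v _ Dv] : (`|d 0%R k| %| p ^ K)%N by have := dK k; rewrite dvdzE abszX.
  rewrite !dvdzE !abszX Dv !dvdn_Pexp2l ?prime_gt1 // eqn_exp2l ?prime_gt1 //; lia.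
rewrite !inE; apply/negP=> /andP[/eqP Dk]; rewrite dvdzE abszX Dk.
by rewrite dvdn_Pexp2l ?prime_gt1 // ltnn.
Qed.

Lemma dvd_countE p i n (d : 'rV[int]_n) :
  dvd_count d p i = \sum_k ((p%:Z ^+ i %| d 0%R k)%Z : nat).
Proof. by rewrite /dvd_count -sum1dep_card big_mkcond. Qed.

Lemma dvd_count_row_mx p i n1 n2 (d1 : 'rV[int]_n1) (d2 : 'rV[int]_n2) :
  dvd_count (row_mx d1 d2) p i = (dvd_count d1 p i + dvd_count d2 p i)%N.
Proof.
rewrite !dvd_countE big_split_ord /=.
by congr (_ + _)%N; apply: eq_bigr => k _; rewrite ?row_mxEl ?row_mxEr.
Qed.

Lemma dvd_count_scalar p (t i : nat) : prime p ->
  dvd_count ((p%:Z ^+ t)%:M : 'rV_1) p i = (i <= t)%N.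
Proof.
move=> pp; rewrite dvd_countE big_ord1 mxE mulr1n.
by rewrite dvdzE !abszX dvdn_Pexp2l ?prime_gt1.
Qed.

Lemma mulmx_const_square n (A : 'M[int]_n) (x : int) :
  A *m const_mx 1 = const_mx x :> 'cV_n -> A *m const_mx 1 = const_mx x :> 'M_n.
Proof.
move=> /matrixP Ax; apply/matrixP=> i j; have := Ax i 0; rewrite !mxE => <-.
by apply: eq_bigr => k _; rewrite !mxE.
Qed.

(** * Splitting off the all-one vector *)

Section SumZeroSplitting.

Variables (m : nat) (A : 'M[int]_(1 + m)) (s : int).
Hypothesis rowA : A *m const_mx 1 = const_mx s :> 'cV_(1 + m).
Hypothesis colA : const_mx 1 *m A = const_mx s :> 'rV_(1 + m).

(* The columns are the all-one vector and the differences [e_k - e_0]. *)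
Definition sum_zero_frame : 'M[int]_(1 + m) :=
  block_mx 1%:M (const_mx (- 1)) (const_mx 1) 1%:M.

(* Matrix of A in the basis [e_k - e_0] of the sum-zero lattice. *)
Definition sum_zero_part : 'M[int]_m := drsubmx A - dlsubmx A *m const_mx 1.

Local Notation T := sum_zero_frame.
Local Notation Y := sum_zero_part.

(** In the application this is the number of lines, which is 1 modulo [p]. *)
Lemma det_sum_zero_frame : \det T = m.+1%:Z.
Proof.
(* Adding all other rows to the first clears the entries [-1] and leaves a lower triangular
   matrix. *)
have : \det (block_mx 1%:M (const_mx 1) 0 1%:M *m T) = m.+1%:Z.
  rewrite /T mulmx_block !mul0mx !mul1mx !mulmx1 !add0r.
  have -> : const_mx (- 1) + const_mx 1 = 0 :> 'rV[int]_m by apply/rowP=> i; rewrite !mxE addNr.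
  rewrite det_lblock det1 mulr1 det_mx11 !mxE (eq_bigr (fun=> 1)) => [|k _]; last by rewrite !mxE mulr1.
  by rewrite sumr_const card_ord -natrD natz.
by rewrite det_mulmx det_ublock !det1 !mul1r.
Qed.

Local Notation a := (ulsubmx A).
Local Notation b := (ursubmx A).
Local Notation c := (dlsubmx A).
Local Notation D := (drsubmx A).
Local Notation u := (const_mx 1 : 'rV[int]_m).
Local Notation v := (const_mx 1 : 'cV[int]_m).

Let const11 x : const_mx x = x%:M :> 'M[int]_1.
Proof. by apply/matrixP=> i j; rewrite !mxE !ord1. Qed.

Let block_sums : [/\ a + b *m v = s%:M, c + D *m v = const_mx s,
  a + u *m c = s%:M & b + u *m D = const_mx s].
Proof.
move: rowA colA; rewrite -{1 2}(submxK A).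
rewrite -(col_mx_const 1 m 1 1) -(row_mx_const 1 1 m 1) -(col_mx_const 1 m 1 s) -(row_mx_const 1 1 m s).
rewrite mul_block_col mul_row_block !const11 !mulmx1 !mul1mx.
by move=> /eq_col_mx[-> ->] /eq_row_mx[-> ->].
Qed.

Let frameE : T = block_mx 1%:M (- u) v 1%:M.
Proof. by congr block_mx; apply/matrixP=> i j; rewrite !mxE. Qed.

(** Constant row sums make the all-one vector an eigenvector; constant column sums make the sum-zero
    lattice stable. *)
Lemma sum_zero_frameP : A *m T = T *m block_mx s%:M 0 0 Y.
Proof.
have [e1 e2 e3 e4] := block_sums.
rewrite -{1}(submxK A) frameE !mulmx_block !mulmx0 !mulmx1 !mul1mx ?addr0 ?add0r.
rewrite e1 e2 mul_mx_scalar scalemx_const mulr1; congr block_mx; last by rewrite mulmxN addrC.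
rewrite mulNmx mulmxBr mulmxA.
have -> : u *m c = s%:M - a by rewrite -e3 addrC addKr.
have -> : u *m D = const_mx s - b by rewrite -e4 addrC addKr.
rewrite mulmxBl mul_scalar_mx scalemx_const mulr1 mulmxN opprB addrC.
by move: (a *m _) b (const_mx s) => X Z W; rewrite opprB [RHS]addrC addrA subrK.
Qed.

Lemma mxtrace_sum_zero_part : \tr Y = \tr A - s.
Proof.
have [_ _ e3 _] := block_sums.
rewrite -[in RHS](submxK A) mxtrace_block raddfB /= mxtrace_mulC.
have -> : u *m c = s%:M - a by rewrite -e3 addrC addKr.
by rewrite raddfB /= mxtrace_scalar mulr1n opprB addrA [\tr D + _]addrC.
Qed.

(** Constant matrices kill sum-zero vectors, so only the scalar term survives in the lower right
    block. *)
Lemma sum_zero_part_quadratic (x y z : int) :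
  A *m A + x *: A = y%:M + const_mx z -> Y *m (Y + x%:M) = y%:M.
Proof.
move=> AA; pose E : 'M_(1 + m) := block_mx s%:M 0 0 Y.
have TE : T *m E = A *m T by rewrite sum_zero_frameP.
have : T *m (E *m E + x *: E - y%:M) = const_mx z *m T.
  rewrite mulmxBr mulmxDr -scalemxAr mulmxA TE -mulmxA TE mulmxA.
  by rewrite scalemxAl -mulmxDl AA mulmxDl -scalar_mxC addrC addKr.
rewrite /E (scalar_mx_block 1 m y) mulmx_block scale_block_mx add_block_mx.
rewrite opp_block_mx add_block_mx !mulmx0 !mul0mx !scaler0 !oppr0 !addr0 !add0r.
rewrite frameE -(block_mx_const 1 m 1 m z) !mulmx_block => /eq_block_mx[_ _ _].
rewrite !mulmx0 !mul1mx !mulmx1 !add0r mulmxN => YE.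
have e : const_mx z *m (const_mx 1 : 'rV[int]_m) = const_mx z :> 'M_m.
  by apply/matrixP=> i j; rewrite !mxE big_ord1 !mxE mulr1.
move: YE; rewrite e addNr => /eqP; rewrite subr_eq0 => /eqP <-.
by rewrite mulmxDr mul_mx_scalar.
Qed.

End SumZeroSplitting.

(** * Assembling the multiplicities from the counts *)

Lemma sum_telescope (e G : nat -> nat) a b : (a <= b)%N ->
  (forall i, e i + G i.+1 = G i)%N -> (\sum_(a <= i < b) e i = G a - G b)%N.
Proof.
move=> ab eG; suff: (\sum_(a <= i < b) e i + G b = G a)%N by move<-; rewrite addnK.
elim: b ab => [|b IH] ab; first by move: ab; rewrite leqn0 => /eqP->; rewrite big_geq.
move: ab; rewrite leq_eqVlt => /predU1P[->|ab]; first by rewrite big_geq.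
by rewrite big_nat_recr //= -addnA eG IH.
Qed.

Lemma dvd_count_homo p n (d : 'rV[int]_n) i j :
  (i <= j)%N -> (dvd_count d p j <= dvd_count d p i)%N.
Proof.
move=> ij; apply: subset_leq_card; apply/subsetP=> k; rewrite !inE.
exact/dvdz_trans/dvdz_exp2l.
Qed.

(** The term [i <= 4 * t] is the share of the all-one vector, with elementary divisor [q^4]. Since
    [G] is decreasing, the two bounds by [g] make it constant from [t.+1] to [2 * t]. *)
Lemma multiplicities_of_counts (t m f g : nat) (e G : nat -> nat) :
  (0 < t)%N -> (f + g)%N = m ->
  (forall i, e i + ((i.+1 <= 4 * t) + G i.+1) = (i <= 4 * t) + G i)%N ->
  {homo G : i j / (i <= j)%N >-> (j <= i)%N} ->
  (forall i, (i <= t)%N -> (G i + G (3 * t - i).+1)%N = m) ->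
  (g <= G (2 * t))%N -> (G t.+1 <= g)%N -> G 0%N = m ->
  [/\ (forall i, (i < t)%N -> e i = e (3 * t - i)%N),
      (forall i, ((t < i < 2 * t) || (3 * t < i < 4 * t) || (4 * t < i))%N ->
          e i = 0%N),
      (\sum_(0 <= i < t.+1) e i = f)%N,
      (\sum_(2 * t <= i < (3 * t).+1) e i = g)%N &
      e (4 * t)%N = 1%N].
Proof.
move=> t0 fg eG Gmono dual G_ge G_le G0.
(* Duality at 0 together with [G 0 = m] gives [G (3 * t).+1 = 0]. *)
have Gbig i : (3 * t < i)%N -> G i = 0%N.
  move=> ti; have := dual 0%N (leq0n t); have := Gmono _ _ ti.
  by rewrite G0 subn0; lia.
have G_t1 : G t.+1 = g by have := Gmono t.+1 (2 * t)%N; lia.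
have G_2t : G (2 * t)%N = g by have := Gmono t.+1 (2 * t)%N; lia.
split.
(* Subtracting duality at [i.+1] from duality at [i] equates the drop of [G] after [i] with the drop
   after [3 * t - i]. *)
- move=> i it; have := eG i; have := eG (3 * t - i)%N.
  have := dual i (ltnW it); have := dual i.+1 it.
  have -> : (3 * t - i.+1).+1 = (3 * t - i)%N by lia.
  lia.
- move=> i /orP[/orP[]|] h; have := eG i.
  + have := Gmono t.+1 i; have := Gmono i.+1 (2 * t)%N; have := Gmono i i.+1 (leqnSn i); lia.
  + rewrite !Gbig; lia.
  + rewrite !Gbig; lia.
- rewrite (sum_telescope _ eG) // G0 G_t1; lia.
- rewrite (sum_telescope _ eG); last by lia.
  rewrite (Gbig (3 * t).+1) // G_2t; lia.
- have := eG (4 * t)%N; rewrite !Gbig; lia.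
Qed.

Lemma elementary_divisors_succ (p t m : nat) (A : 'M[int]_(1 + m)) :
  prime p -> (0 < t)%N ->
  let q := (p ^ t)%N in let e := edmult A p in let z := q%:Z in
  (1 + m = q ^ 4 + q ^ 3 + 2 * q ^ 2 + q + 1)%N ->
  A *m const_mx 1 = const_mx (z ^+ 4) :> 'cV_(1 + m) ->
  const_mx 1 *m A = const_mx (z ^+ 4) :> 'rV_(1 + m) ->
  \tr A = 0 ->
  A *m A + (z ^+ 2 - z) *: A = (z ^+ 3)%:M + const_mx (z ^+ 3 * (z - 1)) ->
  [/\ (forall i, (i < t)%N -> e i = e (3 * t - i)%N),
      (forall i, ((t < i < 2 * t) || (3 * t < i < 4 * t) || (4 * t < i))%N ->
          e i = 0%N),
      (\sum_(0 <= i < t.+1) e i = q ^ 4 + q ^ 2)%N,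
      (\sum_(2 * t <= i < (3 * t).+1) e i = q ^ 3 + q ^ 2 + q)%N &
      e (4 * t)%N = 1%N].
Proof.
move=> pp t0 q e z mE rowA colA trA AA.
have zE : z = p%:Z ^+ t by rewrite /z /q -[LHS]natz natrX natz.
have zX k : (q ^ k)%N%:Z = z ^+ k by rewrite -[LHS]natz natrX natz.
have z4 : z ^+ 4 = p%:Z ^+ (4 * t) by rewrite zE -exprM mulnC.
pose Y := sum_zero_part A; pose T := sum_zero_frame m.
have YY : Y *m (Y + (z ^+ 2 - z)%:M) = (z ^+ 3)%:M.
  exact: sum_zero_part_quadratic rowA colA _ _ _ AA.
have trY : \tr Y + m%:Z * z ^+ 2 = (z ^+ 2 + z) * (q ^ 4 + q ^ 2)%N%:Z.
  rewrite (mxtrace_sum_zero_part rowA colA) trA.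
  have -> : m = (q ^ 4 + q ^ 3 + 2 * q ^ 2 + q)%N by lia.
  by rewrite !PoszD PoszM !zX -/z; ring.
have fg : (q ^ 4 + q ^ 2 + (q ^ 3 + q ^ 2 + q) = m)%N by lia.
have [L [R [d [uL uR AD eE]]]] := snf_exists A.
have [L' [R' [d' [uL' uR' YD _]]]] := snf_exists Y.
have G_ge := count_eigen_ge zE pp fg YY trY uL' uR' YD.
have G_le := count_eigen_le zE pp fg YY trY uL' uR' YD.
have dual := count_dual zE pp YY uL' uR' YD.
set G := dvd_count d' p in G_ge G_le dual.
pose GA := dvd_count d p.
have GAE i : GA i = ((i <= 4 * t) + G i)%N.
  rewrite /GA /G -(@dvd_count_scalar p) // -dvd_count_row_mx -z4.
  have uT : prime_to_det p T.
    have pq : (p %| q)%N by rewrite dvdn_exp.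
    rewrite /prime_to_det det_sum_zero_frame dvdzE /=.
    have -> : m.+1 = (q * (q ^ 3 + q ^ 2 + 2 * q + 1) + 1)%N by lia.
    by rewrite dvdn_addr ?dvdn_mulr // dvdn1 gtn_eqF ?prime_gt1.
  have uB (M : 'M[int]_m) : M \in unitmx -> prime_to_det p (block_mx 1%:M 0 0 M : 'M_(1 + m)).
    by move=> uM; rewrite /prime_to_det det_ublock det1 mul1r; apply: prime_to_det_unit.
  (* These two matrices come from inserting both Smith forms into [A T = T diag(q^4, Y)]. *)
  symmetry; apply: (@count_dvd_eq p i _ (invmx L *m T *m block_mx 1%:M 0 0 L')
     (R *m T *m block_mx 1%:M 0 0 (invmx R'))) => //.
  - by rewrite !prime_to_detM // ?uB // prime_to_det_unit // unitmx_inv.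
  - by rewrite !prime_to_detM // ?uB ?unitmx_inv // prime_to_det_unit.
  move=> k j; set P := _ *m _ *m _; set Q := _ *m _ *m _.
  have : P *m diag_mx (row_mx (z ^+ 4)%:M d') = diag_mx d *m Q.
    have -> : diag_mx (row_mx (z ^+ 4)%:M d') = block_mx (z ^+ 4)%:M 0 0 (diag_mx d').
      by rewrite diag_mx_row; congr block_mx; apply/matrixP=> ? ?; rewrite !mxE !ord1.
    transitivity (invmx L *m (A *m T) *m block_mx 1%:M 0 0 (invmx R')).
      rewrite (sum_zero_frameP rowA colA) /P -!mulmxA !mulmx_block.
      by rewrite !(mulmx0, mul0mx, addr0, add0r, mulmx1, mul1mx) -/Y YD mulmxK.
    by rewrite /Q AD -!mulmxA mulKmx.
  by move/matrixP/(_ k j); rewrite mul_mx_diag mul_diag_mx !mxE => ->; rewrite subrr dvdz0.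
have d_dvd k : (d 0%R k %| p%:Z ^+ (4 * t))%Z.
  (* The cofactor comes from multiplying the quadratic relation by [z] and cancelling the constant
     term with [A J = z^4 J]. *)
  rewrite -z4; suff AZ : A *m (z *: (A + (z ^+ 2 - z)%:M) - (z - 1) *: const_mx 1) = (z ^+ 4)%:M.
    by have := snf_inverse uL AD AZ k k; rewrite eqxx mulr1n => <-; rewrite dvdz_mulr.
  have AJ := mulmx_const_square rowA.
  rewrite mulmxBr -!scalemxAr AJ mulmxDr mul_mx_scalar AA.
  by apply/matrixP=> i j; rewrite !mxE; case: (i == j); rewrite ?mulr1n ?mulr0n; ring.
have eG i : (e i + GA i.+1 = GA i)%N by rewrite /e eE (dvd_count_exact _ pp d_dvd).
have Gmono i j : (i <= j)%N -> (G j <= G i)%N by apply: dvd_count_homo.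
have G0 : G 0%N = m by rewrite -[RHS]card_ord; apply: eq_card => k; rewrite inE expr0 dvd1z.
by apply: (multiplicities_of_counts (G := G) t0 fg) => // i; rewrite -!GAE.
Qed.

Lemma elementary_divisors (p t n : nat) (A : 'M[int]_n) :
  prime p -> (0 < t)%N ->
  let q := (p ^ t)%N in let e := edmult A p in let z := q%:Z in
  (n = q ^ 4 + q ^ 3 + 2 * q ^ 2 + q + 1)%N ->
  A *m const_mx 1 = const_mx (z ^+ 4) :> 'cV_n ->
  const_mx 1 *m A = const_mx (z ^+ 4) :> 'rV_n ->
  \tr A = 0 ->
  A *m A + (z ^+ 2 - z) *: A = (z ^+ 3)%:M + const_mx (z ^+ 3 * (z - 1)) ->
  [/\ (forall i, (i < t)%N -> e i = e (3 * t - i)%N),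
      (forall i, ((t < i < 2 * t) || (3 * t < i < 4 * t) || (4 * t < i))%N ->
          e i = 0%N),
      (\sum_(0 <= i < t.+1) e i = q ^ 4 + q ^ 2)%N,
      (\sum_(2 * t <= i < (3 * t).+1) e i = q ^ 3 + q ^ 2 + q)%N &
      e (4 * t)%N = 1%N].
Proof. by case: n A => [|m] A pp t0 /= nE; [lia | apply: elementary_divisors_succ]. Qed.

(** * Lines of a 4-dimensional space *)

Section Lines.

Local Open Scope nat_scope.

Variable F : finFieldType.
Local Notation q := #|F|.
Local Notation lines := (subsp2 F).
Implicit Types (v w : 'rV[F]_4) (U W : 'M[F]_4).

(** Entries of [N]. Allowing any number of rows lets [U] be a vector too, standing for its span. *)
Definition inc n v (U : 'M[F]_(n, 4)) : nat := (v != 0%R) && (v <= U)%MS.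
Arguments inc {n}.

Let q_gt1 : 1 < q. Proof. exact: card_finNzRing_gt1. Qed.

Lemma linesP U : reflect (\rank U = 2 /\ <<U>>%MS = U) (U \in lines).
Proof. by rewrite inE; apply: (iffP andP) => -[/eqP-> /eqP->]. Qed.

Lemma sum_inc n (U : 'M[F]_(n, 4)) : (\sum_v inc v U).+1 = q ^ \rank U.
Proof.
rewrite -card_rowg -sum1_card [RHS](bigD1 0%R) /= ?mem_rowg ?sub0mx // add1n; congr _.+1.
rewrite [RHS]big_mkcond; apply: eq_bigr => v _; rewrite /inc mem_rowg andbC.
by case: (_ && _).
Qed.

Lemma sum_inc_point v : v != 0%R -> (\sum_w inc w v).+1 = q.
Proof. by move=> v0; rewrite sum_inc rank_rV v0 expn1. Qed.

Lemma inc_cap v U W : inc v U * inc v W = inc v (U :&: W)%MS.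
Proof. by rewrite /inc sub_capmx mulnb; case: (v != 0%R). Qed.

Lemma eqmx_line v w : v != 0%R -> w != 0%R -> (w <= v)%MS -> (w :=: v)%MS.
Proof.
move=> v0 w0 wv; apply/eqmxP; rewrite -(geq_leqif (mxrank_leqif_eq wv)).
by rewrite !rank_rV v0 w0.
Qed.

Lemma line_through v w : v != 0%R -> ~~ (w <= v)%MS ->
  \sum_(U in lines) inc v U * inc w U = 1.
Proof.
move=> v0 wv; have w0 : w != 0%R by apply: contraNneq wv => ->; rewrite sub0mx.
have rk : \rank (v + w)%MS = 2.
  apply/eqP; rewrite eqn_leq (leq_trans (mxrank_adds_leqif _ _)) ?rank_rV ?v0 ?w0 //=.
  have : (v < v + w)%MS by rewrite ltmxE addsmxSl addsmx_sub submx_refl.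
  by rewrite ltmxErank rank_rV v0 => /andP[].
have U0 : <<(v + w)%MS>>%MS \in lines by apply/linesP; rewrite genmx_id mxrank_gen.
rewrite (bigD1 _ U0) /= /inc v0 w0 !genmxE addsmxSl addsmxSr big1 //= => U /andP[/linesP[rU gU] nU].
apply/eqP; rewrite mulnb eqb0; apply: contra nU => /andP[vU wU].
rewrite -gU; apply/eqP/eq_genmx/eqmx_sym/eqmxP.
by rewrite -(geq_leqif (mxrank_leqif_eq _)) ?rk ?rU // addsmx_sub vU.
Qed.

(** Double count of pairs of a vector [w] outside the span of [v] and a line through both: [q^4 - q]
    vectors lie on one line each, and each line through [v] has [q^2 - q] of them. *)
Lemma lines_through_point v : v != 0%R -> \sum_(U in lines) inc v U = q ^ 2 + q + 1.
Proof.
move=> v0; pose out w := ~~ (w <= v)%MS.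
have split (n : nat) (U : 'M[F]_(n, 4)) : (v <= U)%MS ->
    \sum_(w | out w) inc w U + q = q ^ \rank U.
  move=> vU; rewrite -sum_inc [in RHS](bigID out) /= -addnS; congr (_ + _).
  rewrite -[LHS](sum_inc_point v0) (bigID out) /= big1 => [|w].
    by congr _.+1; apply: eq_bigr => w; rewrite negbK /inc => wv; rewrite wv (submx_trans wv vU).
  by rewrite /inc /out andbC => /negPf->.
have count : \sum_(w | out w) 1 + q = q ^ 4.
  rewrite -[4 in RHS](mxrank1 F 4) -(split _ 1%:M%R) ?submx1 //; congr (_ + _).
  apply: eq_bigr => w ow; rewrite /inc submx1 andbT.
  by case: eqP ow => // ->; rewrite /out sub0mx.
have : \sum_(w | out w) \sum_(U in lines) inc v U * inc w U = \sum_(w | out w) 1.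
  by apply: eq_bigr => w; apply: line_through.
rewrite exchange_big /= (eq_bigr (fun U => inc v U * (q ^ 2 - q))) => [|U /linesP[rU _]].
  rewrite -big_distrl /= => E; move: count; rewrite -E => {}E.
  have q2 : 0 < q ^ 2 - q by rewrite subn_gt0 -[X in X < _]expn1 ltn_exp2l.
  apply/eqP; rewrite -(eqn_pmul2r q2) -(eqn_add2r q) E (expnM q 2 2); apply/eqP.
  (* Naming the difference removes truncated subtraction before [ring]. *)
  have : q ^ 2 - q + q = q * q by rewrite subnK -?mulnn // leq_pmulr // ltnW.
  move: (q ^ 2 - q) => d dq; rewrite -!mulnn -dq !(mulnDl, mulnDr) -dq; ring.
rewrite -big_distrr /=; case vU: (v <= U)%MS; last by rewrite /inc vU andbF.
by congr (_ * _); have := split _ U vU; rewrite rU => <-; rewrite addnK.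
Qed.

Lemma sum_inc_line U : U \in lines -> \sum_v inc v U = q ^ 2 - 1.
Proof. by move=> /linesP[rU _]; have := sum_inc U; rewrite rU => <-; rewrite subn1. Qed.

(** Entries of [N N^T]: independent vectors share one line, proportional ones all [q^2 + q + 1]
    lines through a point. *)
Lemma sum_inc_inc v w : \sum_(U in lines) inc v U * inc w U =
  ((v != 0%R) * (w != 0%R)) * (1 + (q ^ 2 + q) * (w <= v)%MS).
Proof.
have [->|v0] := eqVneq v 0%R; first by rewrite !mul0n big1 // => U _; rewrite /inc eqxx.
have [->|w0] := eqVneq w 0%R; first by rewrite muln0 big1 // => U _; rewrite /inc eqxx muln0.
have [wv|wv] := boolP (w <= v)%MS; last by rewrite line_through // muln0.
rewrite /= !mul1n muln1 [RHS]addnC -(lines_through_point v0); apply: eq_bigr => U _.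
by rewrite /inc v0 w0 (eqmx_line v0 w0 wv) mulnb andbb.
Qed.

(** Double count of incident pairs of a nonzero vector and a line, with
    [q^4 - 1 = (q^2 - 1) (q^2 + 1)]. *)
Lemma card_lines : #|lines| = (q ^ 2 + 1) * (q ^ 2 + q + 1).
Proof.
have : \sum_(U in lines) \sum_v inc v U = \sum_(U in lines) (q ^ 2 - 1).
  by apply: eq_bigr => U; apply: sum_inc_line.
rewrite exchange_big /= sum_nat_const.
rewrite (eq_bigr (fun v => inc v 1%:M%R * (q ^ 2 + q + 1))) => [|v _]; last first.
  rewrite {2}/inc submx1 andbT; case: eqVneq => [->|v0].
    by rewrite big1 // => U _; rewrite /inc eqxx.
  by rewrite mul1n lines_through_point.
rewrite -big_distrl /=; have := sum_inc (1%:M : 'M[F]_4); rewrite mxrank1.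
have q2 : 0 < q ^ 2 - 1 by rewrite subn_gt0 -[X in X < _](expn0 q) ltn_exp2l.
move=> E1 E2; apply/eqP; rewrite -(eqn_pmul2r q2) -E2; apply/eqP.
move: E1; set s := \sum_v _ => E1.
have -> : s = (q ^ 2 - 1) * (q ^ 2 + 1) by rewrite -(subn_sqr _ 1) -expnM -E1 subn1.
by move: (q ^ 2 - 1) => d; ring.
Qed.

(** Entries of [N^T N]. *)
Definition common U W : nat := \sum_v inc v U * inc v W.

Lemma commonE U W : (common U W).+1 = q ^ \rank (U :&: W).
Proof. by rewrite -sum_inc; congr _.+1; apply: eq_bigr => v _; rewrite inc_cap. Qed.

Lemma commonC U W : common U W = common W U.
Proof. by apply: eq_bigr => v _; rewrite mulnC. Qed.

Lemma sum_common U : U \in lines ->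
  \sum_(W in lines) common U W = (q ^ 2 - 1) * (q ^ 2 + q + 1).
Proof.
move=> lU; rewrite exchange_big -(sum_inc_line lU) big_distrl /=.
apply: eq_bigr => v _; rewrite -big_distrr /= /inc; case: eqVneq => [//|v0].
by rewrite -(lines_through_point v0) /inc v0.
Qed.

(** Entries of [N^T (N N^T) N]. The second term collects proportional pairs, [q - 1] for each common
    nonzero vector. *)
Lemma sum_common_common U W : U \in lines -> W \in lines ->
  \sum_(K in lines) common U K * common K W =
  (q ^ 2 - 1) ^ 2 + (q ^ 2 + q) * ((q - 1) * common U W).
Proof.
move=> lU lW.
transitivity (\sum_v \sum_w inc v U * inc w W * (1 + (q ^ 2 + q) * (w <= v)%MS)).
  under eq_bigr => K _ do rewrite /common big_distrlr /=.
  rewrite exchange_big; apply: eq_bigr => v _; rewrite exchange_big; apply: eq_bigr => w _ /=.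
  transitivity (inc v U * inc w W * \sum_(K in lines) inc v K * inc w K).
    by rewrite big_distrr; apply: eq_bigr => K _ /=; ring.
  rewrite sum_inc_inc /inc; do 2!case: eqP => //= _; rewrite ?muln0 //; ring.
under eq_bigr => v _ do under eq_bigr => w _ do rewrite mulnDr muln1.
under eq_bigr => v _ do rewrite big_split /=.
rewrite big_split /=; congr (_ + _).
  by rewrite -big_distrlr /= !sum_inc_line.
rewrite /common !big_distrr /=; apply: eq_bigr => v _.
transitivity (inc v U * (q ^ 2 + q) * \sum_w inc w W * (w <= v)%MS).
  by rewrite big_distrr; apply: eq_bigr => w _ /=; ring.
have [->|v0] := eqVneq v 0%R; first by rewrite /inc eqxx /= !mul0n !muln0.
suff -> : \sum_w inc w W * (w <= v)%MS = (q - 1) * inc v W by ring.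
have sv : \sum_w inc w v = q - 1 by rewrite -(sum_inc_point v0) subn1.
rewrite -sv big_distrl /=; apply: eq_bigr => w _.
rewrite /inc v0 /=; have [->|w0] := eqVneq w 0%R => //=.
have [wv|wv] := boolP (w <= v)%MS; last by rewrite muln0.
by rewrite (eqmx_line v0 w0 wv) muln1 mul1n.
Qed.

(** The intersection has dimension 0, 1 or 2, so [common U W] is 0, [q - 1] or [q^2 - 1]. *)
Lemma common_lines U W : U \in lines -> W \in lines ->
  common U W + (q - 1) * ((U :&: W)%MS == 0%R) = (q - 1) * (1 + q * (U == W)).
Proof.
move=> /linesP[rU gU] /linesP[rW gW]; have mUW := commonE U W.
have := mxrankS (capmxSl U W); rewrite rU -mxrank_eq0.
have UW : (\rank (U :&: W) == 2) = (U == W).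
  apply/idP/eqP => [r2|->]; last by rewrite (capmx_idPr (submx_refl W)) rW.
  have cU : (U :&: W == U)%MS by rewrite -(geq_leqif (mxrank_leqif_eq (capmxSl U W))) rU (eqP r2).
  have cW : (U :&: W == W)%MS by rewrite -(geq_leqif (mxrank_leqif_eq (capmxSr U W))) rW (eqP r2).
  by rewrite -gU -gW -(eq_genmx (eqmxP cU)) (eq_genmx (eqmxP cW)).
rewrite -UW; move: mUW; case: (\rank _) => [|[|[|r]]] //= mUW _; nia.
Qed.

End Lines.

(** * The quadratic relation of the disjointness matrix *)

Section DisjointnessMatrix.

Variable F : finFieldType.
Local Notation n := #|subsp2 F|.
Local Notation A := (disj_mx F).
Let z : int := #|F|%:Z.

(** Defining it from [A] avoids dividing [N^T N] by [z - 1]; identities are proved after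
    multiplication by [z - 1], which cancels. *)
Definition common_mx : 'M[int]_n := const_mx 1 + z%:M - A.
Local Notation M := common_mx.

Let z_gt1 : 1 < z. Proof. by rewrite ltz_nat card_finNzRing_gt1. Qed.
Let z1_neq0 : z - 1 != 0. Proof. by rewrite subr_eq0 gt_eqF. Qed.
Let subz1 : (#|F| - 1)%N%:Z = z - 1. Proof. by rewrite -subzn // ltnW ?card_finNzRing_gt1. Qed.
Let zX k : (#|F| ^ k)%N%:Z = z ^+ k. Proof. by rewrite -[LHS]natz natrX natz. Qed.
Let subz2 : (#|F| ^ 2 - 1)%N%:Z = z ^+ 2 - 1.
Proof. by rewrite -subzn ?zX // expn_gt0 ltnW ?card_finNzRing_gt1. Qed.

Let sum_linesE (f : 'M[F]_4 -> nat) :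
  \sum_(k < n) (f (enum_val k))%:Z = (\sum_(U in subsp2 F) f U)%N%:Z.
Proof.
by rewrite -[RHS]natz natr_sum [RHS]big_enum_val; apply: eq_bigr => k _; rewrite natz.
Qed.

Lemma common_mxE i j : (z - 1) * M i j = (common (enum_val i) (enum_val j))%:Z.
Proof.
have := common_lines (enum_valP i) (enum_valP j); rewrite (inj_eq enum_val_inj).
move=> /(congr1 Posz); rewrite PoszD !PoszM subz1 PoszD PoszM -/z !mxE.
move=> mE; rewrite mulrBr; apply/eqP; rewrite subr_eq mE; apply/eqP.
by case: (i == j) => /=; ring.
Qed.

Lemma common_mx_tr : M^T = M.
Proof. by apply/matrixP=> i j; apply: (mulfI z1_neq0); rewrite mxE !common_mxE commonC. Qed.

Lemma common_mx_row : M *m const_mx 1 = const_mx ((z + 1) * (z ^+ 2 + z + 1)) :> 'cV_n.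
Proof.
apply/matrixP=> i j; rewrite !mxE; apply: (mulfI z1_neq0).
transitivity (\sum_(k < n) (common (enum_val i) (enum_val k))%:Z).
  by rewrite mulr_sumr; apply: eq_bigr => k _; rewrite [const_mx _ _ _]mxE mulr1 common_mxE.
rewrite (sum_linesE (common (enum_val i))) sum_common ?enum_valP //.
by rewrite PoszM subz2 !PoszD zX -/z; ring.
Qed.

Lemma common_mx_sqr : M *m M = const_mx ((z + 1) ^+ 2) + (z ^+ 2 + z) *: M.
Proof.
apply/matrixP=> i j; rewrite [LHS]mxE [RHS]mxE [const_mx _ _ _]mxE [(_ *: M) _ _]mxE.
(* One factor [z - 1] for each copy of [M]. *)
apply: (mulfI z1_neq0); apply: (mulfI z1_neq0).
transitivity (\sum_(k < n) (common (enum_val i) (enum_val k) * common (enum_val k) (enum_val j))%N%:Z).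
  by rewrite mulrA mulr_sumr; apply: eq_bigr => k _; rewrite PoszM -!common_mxE; ring.
rewrite (sum_linesE (fun K => common (enum_val i) K * common K (enum_val j))%N).
rewrite sum_common_common ?enum_valP // PoszD !PoszM PoszD zX subz1 -common_mxE.
by rewrite subz2 -/z; ring.
Qed.

Lemma disj_mxE : A = const_mx 1 + z%:M - M.
Proof. by rewrite /M opprB addrC subrK. Qed.

Lemma card_linesE : n%:Z = (z ^+ 2 + 1) * (z ^+ 2 + z + 1).
Proof. by rewrite card_lines PoszM !PoszD zX. Qed.

Lemma disj_mx_tr : A^T = A.
Proof. by apply/matrixP=> i j; rewrite !mxE capmxC. Qed.

Lemma disj_mx_row : A *m const_mx 1 = const_mx (z ^+ 4) :> 'cV_n.
Proof.
rewrite disj_mxE mulmxBl mulmxDl common_mx_row mul_scalar_mx.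
apply/matrixP=> i j; rewrite !mxE (eq_bigr (fun=> 1)) => [|k _]; last by rewrite !mxE mulr1.
(* The row sum is [n + z - (z + 1) (z^2 + z + 1) = z^4]. *)
by rewrite sumr_const card_ord natz card_linesE; ring.
Qed.

Lemma disj_mx_col : const_mx 1 *m A = const_mx (z ^+ 4) :> 'rV_n.
Proof. by rewrite -[LHS]trmxK trmx_mul trmx_const disj_mx_tr disj_mx_row trmx_const. Qed.

Lemma mxtrace_disj_mx : \tr A = 0.
Proof.
rewrite /mxtrace big1 // => i _; rewrite mxE -mxrank_eq0.
have /linesP[rU _] := enum_valP i.
by rewrite (capmx_idPr (submx_refl (enum_val i))) rU.
Qed.

Lemma disj_mx_sqr :
  A *m A + (z ^+ 2 - z) *: A = (z ^+ 3)%:M + const_mx (z ^+ 3 * (z - 1)).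
Proof.
have AJ := mulmx_const_square disj_mx_row.
have JM : const_mx 1 *m M = const_mx ((z + 1) * (z ^+ 2 + z + 1)) :> 'M_n.
  rewrite -[LHS]trmxK trmx_mul trmx_const common_mx_tr.
  by rewrite (mulmx_const_square common_mx_row) trmx_const.
rewrite {2}disj_mxE mulmxBr mulmxDr AJ mul_mx_scalar.
have -> : A *m M = const_mx 1 *m M + z *: M - M *m M.
  by rewrite disj_mxE mulmxBl mulmxDl mul_scalar_mx.
rewrite JM common_mx_sqr disj_mxE; move: M => X; apply/matrixP=> i j; rewrite !mxE.
by case: (i == j); rewrite ?mulr1n ?mulr0n; ring.
Qed.

End DisjointnessMatrix.

Theorem theorem1 (F : finFieldType) (p t : nat) :
  prime p -> (1 <= t)%N -> #|F| = (p ^ t)%N ->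
  let q := (p ^ t)%N in
  let e := fun i => edmult (disj_mx F) p i in
  [/\ (forall i, (i < t)%N -> e i = e (3 * t - i)%N),
      (forall i, ((t < i < 2 * t) || (3 * t < i < 4 * t) || (4 * t < i))%N ->
          e i = 0%N),
      (\sum_(0 <= i < t.+1) e i = q ^ 4 + q ^ 2)%N,
      (\sum_(2 * t <= i < (3 * t).+1) e i = q ^ 3 + q ^ 2 + q)%N &
      e (4 * t)%N = 1%N].
Proof.
move=> pp t0 cF q e; apply: elementary_divisors => //; rewrite -?cF.
- by rewrite card_lines; ring.
- exact: disj_mx_row.
- exact: disj_mx_col.
- exact: mxtrace_disj_mx.
- exact: disj_mx_sqr.
Qed.
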